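(* There is an algorithm which takes a graph $G$ on $n$ vertices as input, runs in $\mathcal{O}^{\star}(1.3734^{n})$ time, and correctly decides whether $G$ is monopolar. If $G$ is monopolar, then this algorithm also outputs one monopolar partition of the vertex set of $G$.
   Context: All graphs are finite, simple and undirected. A graph is a cluster graph if each of its connected components is a complete graph. A partition $V=C\uplus I$ of the vertex set of a graph $G=(V,E)$ is a monopolar partition of $G$ if the induced subgraph $G[C]$ is a cluster graph and $I$ is an independent set in $G$. A graph is monopolar if it has a monopolar partition. The notation $\mathcal{O}^{\star}(f(n))$ means $\mathcal{O}(f(n)\cdot \mathrm{poly}(n))$, i.e. it hides polynomial factors. *)

(* Defs.v *)
From mathcomp Require Import all_boot all_order all_algebra.

Set Implicit Arguments.
Unset Strict Implicit.
Unset Printing Implicit Defensive.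

Record graph (T : finType) := Graph {
  adj :> rel T;
  adj_sym : symmetric adj;
  adj_irr : irreflexive adj
}.

Lemma induced_sym (T : finType) (G : graph T) (S : {set T}) :
  symmetric (relpre (val : {x : T | x \in S} -> T) G).
Proof. by move=> x y; apply: adj_sym. Qed.

Lemma induced_irr (T : finType) (G : graph T) (S : {set T}) :
  irreflexive (relpre (val : {x : T | x \in S} -> T) G).
Proof. by move=> x; apply: adj_irr. Qed.

Definition induced (T : finType) (G : graph T) (S : {set T}) :
    graph {x : T | x \in S} :=
  Graph (@induced_sym T G S) (@induced_irr T G S).

Definition complete_graph (T : finType) (G : graph T) : Prop :=
  forall x y : T, x != y -> G x y.

Definition component (T : finType) (G : graph T) (x : T) : {set T} :=
  [set y | connect G x y].

Definition cluster_graph (T : finType) (G : graph T) : Prop :=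
  forall x : T, complete_graph (induced G (component G x)).

Definition independent (T : finType) (G : graph T) (I : {set T}) : Prop :=
  {in I &, forall x y, ~~ G x y}.

(* Either part may be empty. *)
Definition monopolar_partition (T : finType) (G : graph T) (C I : {set T}) :
    Prop :=
  [/\ C :|: I = [set: T], [disjoint C & I],
      cluster_graph (induced G C) & independent G I].

Definition monopolar (T : finType) (G : graph T) : Prop :=
  exists C I : {set T}, monopolar_partition G C I.

(* Model of computation: a first-order, call-by-value, pure LISP.  The data   *)
(* are binary trees (S-expressions over the single atom Leaf); a program is a *)
(* finite list of mutually recursive unary functions, function 0 being the    *)
(* entry point.  Several arguments are passed as one tree.                    *)
Inductive tree := Leaf | Node of tree & tree.

Definition tree_hd (v : tree) : tree := if v is Node a _ then a else Leaf.
Definition tree_tl (v : tree) : tree := if v is Node _ b then b else Leaf.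

(* Variables are de Bruijn indices: in a function body, before any ELet, the  *)
(* only variable EVar 0 is the argument.                                      *)
Inductive expr :=
  | EVar of nat
  | ELeaf
  | ENode of expr & expr
  | EHd of expr
  | ETl of expr
  | EIf of expr & expr & expr
  | ELet of expr & expr
  | ECall of nat & expr.

Definition program := seq expr.

Definition body (P : program) (f : nat) : expr := nth ELeaf P f.

(* eval P env e v t: in the environment env, e evaluates to v in t steps.     *)
(* Every evaluated occurrence of a constructor of expr costs one step.  The   *)
(* length of env is bounded in terms of P only and values are built one Node  *)
(* at a time and can be shared, so a pointer machine or a random access       *)
(* machine simulates each step in constant time.  EIf takes its first branch  *)
(* exactly when the condition is a Node; head and tail of Leaf, unbound       *)
(* variables and undefined functions all yield Leaf.                          *)
Inductive eval (P : program) : seq tree -> expr -> tree -> nat -> Prop :=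
  | eval_var env i : eval P env (EVar i) (nth Leaf env i) 1
  | eval_leaf env : eval P env ELeaf Leaf 1
  | eval_node env e1 e2 v1 v2 t1 t2 :
      eval P env e1 v1 t1 -> eval P env e2 v2 t2 ->
      eval P env (ENode e1 e2) (Node v1 v2) (t1 + t2).+1
  | eval_hd env e v t :
      eval P env e v t -> eval P env (EHd e) (tree_hd v) t.+1
  | eval_tl env e v t :
      eval P env e v t -> eval P env (ETl e) (tree_tl v) t.+1
  | eval_if_node env e e1 e2 a b v t t1 :
      eval P env e (Node a b) t -> eval P env e1 v t1 ->
      eval P env (EIf e e1 e2) v (t + t1).+1
  | eval_if_leaf env e e1 e2 v t t2 :
      eval P env e Leaf t -> eval P env e2 v t2 ->
      eval P env (EIf e e1 e2) v (t + t2).+1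
  | eval_let env e1 e2 v1 v t1 t2 :
      eval P env e1 v1 t1 -> eval P (v1 :: env) e2 v t2 ->
      eval P env (ELet e1 e2) v (t1 + t2).+1
  | eval_call env f e a v t1 t2 :
      eval P env e a t1 -> eval P [:: a] (body P f) v t2 ->
      eval P env (ECall f e) v (t1 + t2).+1.

Lemma eval_det (P : program) env e v t v' t' :
  eval P env e v t -> eval P env e v' t' -> v = v' /\ t = t'.
Proof.
move=> H; move: v' t'; induction H => v' t' H'; inversion H'; subst => //;
repeat match goal with
| IH : forall _ _, eval P ?env ?e _ _ -> _, He : eval P ?env ?e _ _ |- _ =>
    have [? ?] := IH _ _ He; clear He; subst
end; by [].
Qed.

Definition run (P : program) (input output : tree) (t : nat) : Prop :=
  eval P [:: input] (body P 0) output t.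

Definition enc_bool (b : bool) : tree := if b then Node Leaf Leaf else Leaf.

Definition enc_seq (s : seq tree) : tree := foldr Node Leaf s.

(* The adjacency matrix, as the list of its rows. *)
Definition enc_graph (n : nat) (G : graph 'I_n) : tree :=
  enc_seq [seq enc_seq [seq enc_bool (G i j) | j <- enum 'I_n]
              | i <- enum 'I_n].

Definition enc_set (n : nat) (A : {set 'I_n}) : tree :=
  enc_seq [seq enc_bool (i \in A) | i <- enum 'I_n].

(* The answer "no" is the tree Leaf; "yes" is a Node holding both parts. *)
Definition enc_answer (n : nat) (o : option ({set 'I_n} * {set 'I_n})) : tree :=
  if o is Some (C, J) then Node (enc_set C) (enc_set J) else Leaf.

Definition correct_answer (n : nat) (G : graph 'I_n)
    (o : option ({set 'I_n} * {set 'I_n})) : Prop :=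
  if o is Some (C, J) then monopolar_partition G C J else ~ monopolar G.

(* T is O(f(n) * poly(n)). *)
Definition Ostar (f : nat -> rat) (T : nat -> nat) : Prop :=
  exists (p : {poly rat}) (N : nat),
    forall n : nat, N <= n -> ((T n)%:R <= p.[n%:R] * f n)%R.

(* Main.v *)
(* Label every vertex C, I or undecided.  The constraints are that a neighbour *)
(* of an I-vertex is in C and that an induced path on three vertices has one   *)
(* of them in I.  As soon as the undecided vertices induce a graph of maximum  *)
(* degree at most 1, every open constraint involves at most two of them, so    *)
(* that the rest is an instance of 2-SAT, solved by unit propagation with      *)
(* limited backtracking.  Otherwise we branch on an undecided vertex v of      *)
(* maximum degree in the undecided graph: v in I decides v and all its         *)
(* neighbours, v in C decides v and lowers the degree of its neighbours.  With *)
(* weights 0, 16, 25 for undecided vertices of degree 0, 1, 2 and weight 26    *)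
(* for larger degrees, the total weight M satisfies r^M1 + r^M2 <= r^M in      *)
(* every branching for r = 165/163, and r^26 <= 1.3734.                        *)
Require Import Defs.
From mathcomp Require Import all_boot all_order all_algebra.
From mathcomp Require Import zify ring lra.
Import Order.TTheory GRing.Theory Num.Theory.

Set Implicit Arguments.
Unset Strict Implicit.
Unset Printing Implicit Defensive.

(** * A loop language compiled to programs *)

(** A partition is monopolar iff no edge lies inside I and every induced path on three vertices
    meets I ([validP], via [cluster_graphP]). Unit propagation applies to these clauses: a neighbour
    of an I-vertex goes to C, and a path with two vertices in C sends the third to I. Otherwise a
    vertex of maximum degree is tried on both sides.

    For the time bound, a node of the search tree is charged r to the power of the measure of its
    [residual] set. [branching_cover] reduces the possible losses of measure to twelve pairs, and r
    = 165/163 then gives [measure_branch]. The depth of the tree is at most linear and the measure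
    at most 26 n, so [solve_residual] yields a polynomial times (r^26)^n.

    The algorithm must also be a program of the model. All work at a single search node is written
    in a language whose loops run n times; [compile_evals] and [cost_poly] give its correctness and
    polynomial cost once and for all. Only the recursion over the search tree is programmed by
    hand. *)

Fixpoint spine (t : tree) : nat := if t is Node _ b then (spine b).+1 else 0.

Definition is_node (t : tree) : bool := if t is Node _ _ then true else false.

Lemma is_node_enc_bool b : is_node (enc_bool b) = b.
Proof. by case: b. Qed.

(* Expressions over an argument and a global tree, whose only loops iterate as *)
(* often as the right spine of the global tree is long: their cost is thus     *)
(* polynomial whatever the values are.  HIter k b a iterates b, which receives *)
(* the state and the argument, from a; k is the index of the function which    *)
(* implements the loop.                                                        *)
Inductive hexpr :=
  | HArg
  | HGlob
  | HLeaf
  | HNode of hexpr & hexpr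
  | HHd of hexpr
  | HTl of hexpr
  | HIf of hexpr & hexpr & hexpr
  | HApp of hexpr & hexpr
  | HIter of nat & hexpr & hexpr.

Fixpoint den (g x : tree) (e : hexpr) : tree :=
  match e with
  | HArg => x
  | HGlob => g
  | HLeaf => Leaf
  | HNode a b => Node (den g x a) (den g x b)
  | HHd a => tree_hd (den g x a)
  | HTl a => tree_tl (den g x a)
  | HIf a b c => if is_node (den g x a) then den g x b else den g x c
  | HApp f a => den g (den g x a) f
  | HIter _ b a => iter (spine g) (fun s => den g (Node s x) b) (den g x a)
  end.

Fixpoint compile (e : hexpr) : expr :=
  match e with
  | HArg => ETl (EVar 0)
  | HGlob => EHd (EVar 0)
  | HLeaf => ELeaf
  | HNode a b => ENode (compile a) (compile b)
  | HHd a => EHd (compile a)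
  | HTl a => ETl (compile a)
  | HIf a b c => EIf (compile a) (compile b) (compile c)
  | HApp f a => ELet (ENode (EHd (EVar 0)) (compile a)) (compile f)
  | HIter k _ a => ECall k (ENode (EHd (EVar 0)) (ENode (compile a) (EVar 0)))
  end.

(** The argument consists of a counter, the state, and the pair of global tree and argument. Each
    round removes one cell of the counter. *)
Definition loop_body (k : nat) (b : hexpr) : expr :=
  let s := EHd (ETl (EVar 0)) in
  let gx := ETl (ETl (EVar 0)) in
  EIf (EHd (EVar 0))
    (ECall k (ENode (ETl (EHd (EVar 0)))
       (ENode (ELet (ENode (EHd gx) (ENode s (ETl gx))) (compile b)) gx)))
    s.

(** Here [n] is the number of rounds of every loop. Both branches of a conditional are counted, so
    the bound depends on no value. *)
Fixpoint cost (n : nat) (e : hexpr) : nat :=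
  match e with
  | HArg | HGlob => 2
  | HLeaf => 1
  | HNode a b => cost n a + cost n b + 1
  | HHd a | HTl a => cost n a + 1
  | HIf a b c => cost n a + cost n b + cost n c + 1
  | HApp f a => cost n a + cost n f + 4
  | HIter _ b a => cost n a + n * (cost n b + 30) + 13
  end.

(** Compiled code mentions a loop only by its number, so [P] must hold the matching body there. *)
Fixpoint linked (P : program) (e : hexpr) : Prop :=
  match e with
  | HArg | HGlob | HLeaf => True
  | HNode a b | HApp a b => linked P a /\ linked P b
  | HHd a | HTl a => linked P a
  | HIf a b c => [/\ linked P a, linked P b & linked P c]
  | HIter k b a => [/\ body P k = loop_body k b, linked P b & linked P a]
  end.

Definition evals (P : program) env e v (T : nat) : Prop :=
  exists2 t, t <= T & eval P env e v t.

Section Evals.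
Variables (P : program) (env : seq tree).

Lemma evals_le e v T T' : T <= T' -> evals P env e v T -> evals P env e v T'.
Proof. by move=> le [t lt ev]; exists t => //; apply: leq_trans le. Qed.

Lemma evals_var i : evals P env (EVar i) (nth Leaf env i) 1.
Proof. by exists 1 => //; apply: eval_var. Qed.

Lemma evals_leaf : evals P env ELeaf Leaf 1.
Proof. by exists 1 => //; apply: eval_leaf. Qed.

Lemma evals_node e1 e2 v1 v2 T1 T2 :
  evals P env e1 v1 T1 -> evals P env e2 v2 T2 ->
  evals P env (ENode e1 e2) (Node v1 v2) (T1 + T2 + 1).
Proof.
move=> [t1 l1 H1] [t2 l2 H2]; exists (t1 + t2).+1; last exact: eval_node.
by rewrite addn1 ltnS leq_add.
Qed.

Lemma evals_hd e v T :
  evals P env e v T -> evals P env (EHd e) (tree_hd v) (T + 1).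
Proof.
by move=> [t l H]; exists t.+1; [rewrite addn1 | apply: eval_hd].
Qed.

Lemma evals_tl e v T :
  evals P env e v T -> evals P env (ETl e) (tree_tl v) (T + 1).
Proof.
by move=> [t l H]; exists t.+1; [rewrite addn1 | apply: eval_tl].
Qed.

Lemma evals_if e e1 e2 w v1 v2 T T1 T2 :
  evals P env e w T ->
  (is_node w -> evals P env e1 v1 T1) ->
  (~~ is_node w -> evals P env e2 v2 T2) ->
  evals P env (EIf e e1 e2) (if is_node w then v1 else v2)
    (T + (if is_node w then T1 else T2) + 1).
Proof.
case: w => [|a b] [t l H] /= H1 H2.
  have [t2 l2 {}H2] := H2 isT; exists (t + t2).+1.
    by rewrite addn1 ltnS leq_add.
  exact: eval_if_leaf.
have [t1 l1 {}H1] := H1 isT; exists (t + t1).+1.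
  by rewrite addn1 ltnS leq_add.
exact: eval_if_node H H1.
Qed.

Lemma evals_let e1 e2 v1 v T1 T2 :
  evals P env e1 v1 T1 -> evals P (v1 :: env) e2 v T2 ->
  evals P env (ELet e1 e2) v (T1 + T2 + 1).
Proof.
move=> [t1 l1 H1] [t2 l2 H2]; exists (t1 + t2).+1; last exact: eval_let H1 H2.
by rewrite addn1 ltnS leq_add.
Qed.

Lemma evals_call f e a v T1 T2 :
  evals P env e a T1 -> evals P [:: a] (body P f) v T2 ->
  evals P env (ECall f e) v (T1 + T2 + 1).
Proof.
move=> [t1 l1 H1] [t2 l2 H2]; exists (t1 + t2).+1; last exact: eval_call H1 H2.
by rewrite addn1 ltnS leq_add.
Qed.

End Evals.

Lemma iter_loop P k b g x c s T :
  body P k = loop_body k b ->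
  (forall s env, evals P (Node g (Node s x) :: env) (compile b)
                   (den g (Node s x) b) T) ->
  evals P [:: Node c (Node s (Node g x))] (body P k)
    (iter (spine c) (fun s => den g (Node s x) b) s) (spine c * (T + 30) + 6).
Proof.
move=> Pk Hb; rewrite Pk.
elim: {c}(spine c) {-2}c s (erefl (spine c)) => [|m IHm] c s.
  case: c => // _; apply: evals_le; last first.
    apply: (@evals_if _ _ _ _ _ Leaf Leaf s 2 1 3) => //=.
    - exact: (evals_hd (evals_var _ _ 0)).
    - by move=> _; exact: (evals_hd (evals_tl (evals_var _ _ 0))).
  by [].
case: c => // c1 c [Em]; rewrite iterSr.
apply: evals_le; last first.
  apply: (@evals_if _ _ _ _ _ (Node c1 c) _ Leaf 2 _ 0) => //=.
    exact: (evals_hd (evals_var _ _ 0)).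
  move=> _; apply: evals_call.
    apply: evals_node.
      exact: (evals_tl (evals_hd (evals_var _ _ 0))).
    apply: evals_node.
      apply: evals_let; last exact: (Hb s).
      apply: evals_node.
        exact: (evals_hd (evals_tl (evals_tl (evals_var _ _ 0)))).
      apply: evals_node.
        exact: (evals_hd (evals_tl (evals_var _ _ 0))).
      exact: (evals_tl (evals_tl (evals_tl (evals_var _ _ 0)))).
    exact: (evals_tl (evals_tl (evals_var _ _ 0))).
  by rewrite Pk; apply: IHm.
by rewrite /= mulSn; lia.
Qed.

Lemma compile_evals P e : linked P e -> forall g x env,
  evals P (Node g x :: env) (compile e) (den g x e) (cost (spine g) e).
Proof.
elim: e => /=.
- by move=> _ g x env; exact: (evals_tl (evals_var _ _ 0)).
- by move=> _ g x env; exact: (evals_hd (evals_var _ _ 0)).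
- by move=> _ g x env; exact: evals_leaf.
- move=> a IHa b IHb [/IHa {}IHa /IHb {}IHb] g x env.
  exact: evals_node.
- by move=> a IHa /IHa {}IHa g x env; exact: evals_hd.
- by move=> a IHa /IHa {}IHa g x env; exact: evals_tl.
- move=> a IHa b IHb c IHc [/IHa {}IHa /IHb {}IHb /IHc {}IHc] g x env.
  apply: evals_le; last exact: evals_if.
  by case: ifP; lia.
- move=> f IHf a IHa [/IHf {}IHf /IHa {}IHa] g x env.
  apply: evals_le; last first.
    apply: evals_let; last exact: IHf.
    apply: evals_node; last exact: IHa.
    exact: (evals_hd (evals_var _ _ 0)).
  lia.
- move=> k b IHb a IHa [Pk /IHb {}IHb /IHa {}IHa] g x env.
  apply: evals_le; last first.
    apply: evals_call.
      apply: evals_node.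
        exact: (evals_hd (evals_var _ _ 0)).
      apply: evals_node; [exact: IHa | exact: (evals_var _ _ 0)].
    by apply: iter_loop Pk _ => s env'; exact: IHb.
  by rewrite /=; lia.
Qed.

Lemma cost_poly e :
  exists p : {poly rat}, forall n : nat, ((cost n e)%:R = p.[n%:R])%R.
Proof.
have cst c : exists p : {poly rat}, forall n : nat, (c%:R = p.[n%:R])%R.
  by exists c%:R%:P%R => n; rewrite hornerC.
elim: e => /=; try exact: cst.
- move=> a [p Hp] b [q Hq]; exists (p + q + 1)%R => n.
  by rewrite !natrD !hornerD hornerC Hp Hq.
- by move=> a [p Hp]; exists (p + 1)%R => n; rewrite natrD hornerD hornerC Hp.
- by move=> a [p Hp]; exists (p + 1)%R => n; rewrite natrD hornerD hornerC Hp.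
- move=> a [p Hp] b [q Hq] c [r Hr]; exists (p + q + r + 1)%R => n.
  by rewrite !natrD !hornerD hornerC Hp Hq Hr.
- move=> a [p Hp] b [q Hq]; exists (q + p + 4%:R%:P)%R => n.
  by rewrite !natrD !hornerD hornerC Hp Hq.
- move=> _ b [q Hq] a [p Hp]; exists (p + 'X * (q + 30%:R%:P) + 13%:R%:P)%R => n.
  by rewrite !natrD natrM natrD !hornerD hornerM hornerX hornerD !hornerC Hp Hq.
Qed.

(** * Monopolar partitions as a constraint satisfaction problem *)

(** Without induced paths on three vertices, induction along a walk shows that connected vertices
    are equal or adjacent. *)
Lemma cluster_graphP (T : finType) (G : graph T) :
  cluster_graph G <->
  forall x y z, G x y -> G y z -> x != z -> G x z.
Proof.
split=> [clG x y z xy yz xz | P3free x].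
  have cx w : connect G x w -> w \in component G x by rewrite inE.
  have xc := cx x (connect0 _ _).
  have zc := cx z (connect_trans (connect1 xy) (connect1 yz)).
  exact: (clG x (exist _ x xc) (exist _ z zc)).
have conn y : connect G x y -> x = y \/ G x y.
  case/connectP=> p Gp ->; elim/last_ind: p Gp => [|p z IHp]; first by left.
  rewrite rcons_path last_rcons => /andP[/IHp[<- | xp] pz]; first by right.
  by have [->|xz] := eqVneq x z; [left | right; apply: P3free xp pz xz].
move=> [y /= yc] [z /= zc]; rewrite -val_eqE /=; move: yc zc; rewrite !inE.
move=> /conn[<- | xy] /conn[<- | xz] //; first by rewrite eqxx.
  by rewrite adj_sym.
by apply: P3free xz; rewrite adj_sym.
Qed.

Section Labels.
Variables (T : finType) (G : graph T).
Implicit Types (v a b u : T) (s : {ffun T -> bool}) (L : {ffun T -> option bool}).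

Definition adjr a b := (a == b) || G a b.

Lemma adjr_sym a b : adjr a b = adjr b a.
Proof. by rewrite /adjr eq_sym adj_sym. Qed.

(* The vertices induce a path on three vertices with the edge v a and the end  *)
(* b: since adjr is reflexive, coinciding vertices are excluded.               *)
Definition p3 v a b := G v a && (adjr a b != adjr v b).

Lemma p3_swap v a b : p3 v a b -> p3 a v b.
Proof. by rewrite /p3 adj_sym eq_sym. Qed.

(** The end [b] lies on an edge with whichever of [v] and [a] is the middle. Together with
    [p3_swap], any vertex of the path can be put first, so [forcedI] need only treat the first
    place. *)
Lemma p3_rot v a b : p3 v a b -> p3 b v a \/ p3 b a v.
Proof.
case/andP=> va; rewrite /p3 (adjr_sym v a) [adjr b a]adjr_sym [adjr b v]adjr_sym.
have -> : adjr a v by rewrite /adjr adj_sym va orbT.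
have [<-|ab] := eqVneq a b; first by rewrite /adjr eqxx va orbT.
have [<-|vb] := eqVneq v b; first by rewrite /adjr eqxx adj_sym va orbT.
rewrite /adjr (negPf ab) (negPf vb) /= [G b v]adj_sym [G b a]adj_sym.
by case: (G a b); case: (G v b) => // _; [right | left].
Qed.

(* s v = true puts v into the independent part. *)
Definition valid s : Prop :=
  (forall u v, G u v -> ~~ (s u && s v)) /\
  (forall v a b, p3 v a b -> [|| s v, s a | s b]).

Lemma validP s :
  valid s <-> monopolar_partition G [set v | ~~ s v] [set v | s v].
Proof.
have clP : cluster_graph (induced G [set v | ~~ s v]) <->
    (forall x y z, ~~ s x -> ~~ s y -> ~~ s z -> G x y -> G y z -> x != z ->
       G x z).
  rewrite cluster_graphP; split=> [H x y z sx sy sz | H].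
    have mem u : ~~ s u -> u \in [set v | ~~ s v] by rewrite inE.
    exact: (H (exist _ x (mem x sx)) (exist _ y (mem y sy)) (exist _ z (mem z sz))).
  move=> [x xc] [y yc] [z zc]; rewrite -val_eqE /=.
  by move: xc yc zc; rewrite !inE => sx sy sz; apply: H.
split=> [[indep cl] | [_ _ /clP cl indep]]; split.
- by apply/setP=> v; rewrite !inE; case: (s v).
- by rewrite -setI_eq0; apply/eqP/setP=> v; rewrite !inE; case: (s v).
- apply/clP=> x y z /negPf sx /negPf sy /negPf sz xy yz xz.
  have := cl x y z; rewrite /p3 xy sx sy sz /adjr yz orbT (negPf xz) /=.
  by case: (G x z) => // ->.
- move=> u v; rewrite !inE => su sv; apply/negP=> uv.
  by have := indep u v uv; rewrite su sv.
- move=> u v uv; apply/negP=> /andP[su sv].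
  by have := indep u v; rewrite !inE su sv uv => /(_ isT isT).
- move=> v a b /andP[va]; apply: contraR; rewrite !negb_or => /and3P[sv sa sb].
  rewrite /adjr.
  have [<-|ab] := eqVneq a b; first by rewrite va orbT.
  have [<-|vb] := eqVneq v b; first by rewrite adj_sym va.
  apply/eqP; apply/idP/idP=> /= [ab' | vb']; first exact: (cl v a b).
  by apply: (cl a v b) => //; rewrite adj_sym.
Qed.

Lemma monopolarP : monopolar G <-> exists s, valid s.
Proof.
split=> [[C [I part]] | [s /validP]]; last by exists [set v | ~~ s v], [set v | s v].
exists [ffun v => v \in I]; apply/validP.
have -> : [set v | [ffun v => v \in I] v] = I by apply/setP=> v; rewrite inE ffunE.
suff -> : [set v | ~~ [ffun v => v \in I] v] = C by [].
case: part => CUI /pred0P dis _ _; apply/setP=> v; rewrite inE ffunE.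
have := dis v; have /setP/(_ v) := CUI; rewrite !inE /=.
by case: (v \in C); case: (v \in I).
Qed.

Definition extends s L := forall v c, L v = Some c -> s v = c.
Definition refines L' L := forall v c, L v = Some c -> L' v = Some c.
Definition solvable L := exists2 s, valid s & extends s L.

Definition forcedC L v := [exists u, G v u && (L u == Some true)].
Definition forcedI L v :=
  [exists a, exists b,
     [&& L a == Some false, L b == Some false & p3 v a b]].
(** Covers both a pending propagation ([v] undecided) and a conflict ([v] labelled otherwise);
    [bad_sound] separates the two. *)
Definition bad L v :=
  forcedC L v && (L v != Some false) || forcedI L v && (L v != Some true).
Definition propagated L := forall v, ~~ bad L v.

Definition setl L v c : {ffun T -> option bool} :=
  [ffun u => if u == v then Some c else L u].

Definition undecided L := [set v | L v == None].

(* These contain all vertices that remain undecided after propagation. *)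
Definition residual L := [set v in undecided L | ~~ forcedC L v].

Lemma forcedC_sound s L v :
  valid s -> extends s L -> forcedC L v -> s v = false.
Proof.
move=> [indep _] ext /existsP[u /andP[vu /eqP/ext su]].
by have := indep v u vu; rewrite su andbT => /negPf.
Qed.

Lemma forcedI_sound s L v :
  valid s -> extends s L -> forcedI L v -> s v.
Proof.
move=> [_ cl] ext /existsP[a /existsP[b /and3P[/eqP/ext sa /eqP/ext sb]]].
by move/cl; rewrite sa sb !orbF.
Qed.

(** A bad vertex is forced into C or into I, so every valid extension has the forced value there; a
    label already present would contradict it. *)
Lemma bad_sound s L v : valid s -> extends s L -> bad L v ->
  L v = None /\ extends s (setl L v (~~ forcedC L v)).
Proof.
move=> vs ext badv.
have sv : s v = ~~ forcedC L v.
  case: (boolP (forcedC L v)) => [/(forcedC_sound vs ext) // | nC].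
  move: badv; rewrite /bad (negPf nC) /= => /andP[+ _].
  exact: forcedI_sound vs ext.
split.
  case E: (L v) => [c|] //; have := ext v c E; move: badv; rewrite sv /bad E.
  case: (boolP (forcedC L v)) => [fC | nC] /=; last first.
    by move=> /andP[_ +] Ec; rewrite -Ec.
  move=> + Ec; rewrite -Ec /= andbT => /(forcedI_sound vs ext).
  by rewrite sv fC.
move=> u c; rewrite ffunE; case: eqP => [-> [<-] // | _]; exact: ext.
Qed.

Lemma solvable_branch L v :
  solvable L -> solvable (setl L v true) \/ solvable (setl L v false).
Proof.
case=> s vs ext; case sv: (s v); [left | right]; exists s => // u c;
  by rewrite ffunE; case: eqP => [-> [<-] // | _]; apply: ext.
Qed.

Lemma refines_trans L1 L2 L3 : refines L2 L1 -> refines L3 L2 -> refines L3 L1.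
Proof. by move=> r12 r23 v c /r12/r23. Qed.

Lemma refines_setl L v c : L v = None -> refines (setl L v c) L.
Proof. by move=> Lv u d Lu; rewrite ffunE; case: eqP => // uv; rewrite uv Lv in Lu. Qed.

Lemma propagated_forcedC L u v : propagated L -> G v u -> L u = Some true -> L v = Some false.
Proof.
move=> propL vu Lu; apply/eqP; apply: contraT => nLv; have := propL v.
rewrite /bad nLv andbT negb_or => /andP[/existsP[]].
by exists u; rewrite vu Lu.
Qed.

Lemma propagated_forcedI L v a b : propagated L -> p3 v a b ->
  L a = Some false -> L b = Some false -> L v = Some true.
Proof.
move=> propL vab La Lb; apply/eqP; apply: contraT => nLv; have := propL v.
rewrite /bad nLv andbT negb_or => /andP[_ /existsP[]].
by exists a; apply/existsP; exists b; rewrite vab La Lb.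
Qed.

Lemma propagated_valid L : propagated L -> undecided L = set0 ->
  valid [ffun v => L v == Some true].
Proof.
move=> propL U0; have dec v : L v == Some true = false -> L v = Some false.
  by have /setP/(_ v) := U0; rewrite !inE; case: (L v) => [[]|].
split=> [u v uv | v a b vab]; rewrite !ffunE.
  apply/negP=> /andP[/eqP Lu /eqP Lv].
  by have := propagated_forcedC propL uv Lv; rewrite Lu.
case Ea: (L a == Some true); first by rewrite orbT.
case Eb: (L b == Some true); first by rewrite !orbT.
by rewrite (propagated_forcedI propL vab (dec a Ea) (dec b Eb)).
Qed.

Definition deg (U : {set T}) v := #|[set u in U | G v u]|.

Lemma p3_deg (U : {set T}) v a b : v \in U -> a \in U -> b \in U -> p3 v a b ->
  exists2 c, c \in U & 1 < deg U c.
Proof.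
have two c x y : x \in U -> y \in U -> G c x -> G c y -> x != y -> 1 < deg U c.
  by move=> xU yU cx cy xy; apply/card_gt1P; exists x, y; rewrite !inE ?xU ?yU.
move=> vU aU bU /andP[va]; rewrite /adjr.
have [<-|ab] := eqVneq a b; first by rewrite va orbT.
have [<-|vb] := eqVneq v b; first by rewrite adj_sym va.
case ab': (G a b); case vb': (G v b) => //= _.
  by exists a => //; apply: (two a v b) => //; rewrite adj_sym.
by exists v => //; apply: (two v a b).
Qed.

(* Without an undecided induced path on three vertices every open clause has   *)
(* at most two undecided vertices, and the limited backtracking of 2-SAT       *)
(* applies: a conflict-free propagation may be kept.                           *)
Lemma solvable_refines L L' :
  {in undecided L, forall v, deg (undecided L) v <= 1} ->
  propagated L' -> refines L' L -> solvable L -> solvable L'.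
Proof.
move=> deg1 propL' ref [s [indep cl] ext].
pose s' : {ffun T -> bool} := [ffun v => odflt (s v) (L' v)].
exists s'; last by move=> v c E; rewrite ffunE E.
have s'C v : s' v = false -> L' v <> None -> L' v = Some false.
  by rewrite ffunE; case: (L' v) => [[]|].
split=> [u v uv | v a b vab].
  rewrite !ffunE; apply/negP; case Eu: (L' u) => [[]|] //=.
    by rewrite (@propagated_forcedC L' u v) // adj_sym.
  case Ev: (L' v) => [[]|] /=; rewrite ?andbF //; last first.
    by apply/negP; apply: indep.
  by have := propagated_forcedC propL' uv Ev; rewrite Eu.
(* Suppose a path lies in C under [s'] and [L'] newly decided [x]. If [L'] also decided [y] or [z],
   propagation would put the remaining vertex into I. So all three were undecided in [L], and the
   middle one had degree 2 there. *)
have noP3 x y z : p3 x y z -> s' x = false -> s' y = false -> s' z = false ->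
    L x = None -> L' x <> None -> False.
  move=> xyz sx sy sz Lx L'x.
  have L'xE := s'C _ sx L'x.
  have undec w : w \in undecided L \/ L w <> None.
    by rewrite inE; case: (L w); [right | left].
  have Lnone w : L' w = None -> w \in undecided L.
    by rewrite inE; case E: (L w) => [c|] //; rewrite (ref w c E).
  have Ly : L' y = None.
    case E: (L' y) => [c|] //; have L'y : L' y = Some false by apply: s'C; rewrite ?E.
    move: sz; rewrite ffunE; case/p3_rot: xyz => zxy;
      by rewrite (propagated_forcedI propL' zxy).
  have Lz : L' z = None.
    case E: (L' z) => [c|] //; have L'z : L' z = Some false by apply: s'C; rewrite ?E.
    by move: Ly; rewrite (propagated_forcedI propL' (p3_swap xyz)).
  have xU : x \in undecided L by rewrite inE Lx.
  have [c cU] := p3_deg xU (Lnone _ Ly) (Lnone _ Lz) xyz.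
  by rewrite ltnNge deg1.
apply: contraT; rewrite !negb_or => /and3P[/negPf sv /negPf sa /negPf sb].
(* Only vertices newly decided by [L'] can change their value, and [noP3] excludes these; so [s]
   itself would violate the clause. *)
have same w : (L w = None -> L' w <> None -> False) -> s' w = s w.
  move=> H; rewrite ffunE; case E: (L w) => [c|]; last first.
    by case E': (L' w) => [c|] //; case: H; rewrite ?E'.
  by rewrite (ref w c E) (ext w c E).
have sv' : s' v = s v by apply: same; apply: noP3 vab sv sa sb.
have sa' : s' a = s a by apply: same; apply: noP3 (p3_swap vab) sa sv sb.
have sb' : s' b = s b.
  by apply: same; case/p3_rot: vab => bp3; apply: noP3 bp3 _ _ _.
by have := cl v a b vab; rewrite -sv' -sa' -sb' sv sa sb.
Qed.

Lemma undecided_residual L L' :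
  refines L' L -> propagated L' -> undecided L' \subset residual L.
Proof.
move=> ref propL'; apply/subsetP=> v; rewrite !inE => /eqP L'v.
case E: (L v) => [c|]; first by rewrite (ref v c E) in L'v.
apply/existsP=> -[u /andP[vu /eqP/ref L'u]].
by rewrite (propagated_forcedC propL' vu L'u) in L'v.
Qed.

(** The neighbours of [v] leave the residual set at once, although they are labelled only by the
    propagation of the next call. This is why the measure is taken on [residual]. *)
Lemma residual_setl_true L v :
  residual (setl L v true) \subset
  undecided L :\: (v |: [set u in undecided L | G v u]).
Proof.
apply/subsetP=> u; rewrite !inE ffunE; case: (eqVneq u v) => //= uv /andP[Lu].
rewrite Lu /= andbT; apply: contra => vu; apply/existsP; exists v.
by rewrite adj_sym vu ffunE eqxx.
Qed.

Lemma residual_setl_false L v :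
  residual (setl L v false) \subset undecided L :\ v.
Proof.
by apply/subsetP=> u; rewrite !inE ffunE; case: (eqVneq u v) => //= uv /andP[].
Qed.

End Labels.

(** * Loops over the vertices *)

Definition htrue := HNode HLeaf HLeaf.
Definition hnot a := HIf a HLeaf htrue.
Definition hand a b := HIf a b HLeaf.
Definition hor a b := HIf a htrue b.
Definition hxor a b := HIf a (hnot b) b.

Section Booleans.
Variables (g x : tree) (a b : hexpr).

Lemma den_hnot : is_node (den g x (hnot a)) = ~~ is_node (den g x a).
Proof. by rewrite /=; case: ifP. Qed.

Lemma den_hand :
  is_node (den g x (hand a b)) = is_node (den g x a) && is_node (den g x b).
Proof. by rewrite /=; case: ifP. Qed.

Lemma den_hor :
  is_node (den g x (hor a b)) = is_node (den g x a) || is_node (den g x b).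
Proof. by rewrite /=; case: ifP. Qed.

Lemma den_hxor :
  is_node (den g x (hxor a b)) = (is_node (den g x a) != is_node (den g x b)).
Proof.
by rewrite /=; case: (is_node (den g x a)); case: (is_node (den g x b)).
Qed.

End Booleans.

(** Shortens both components in step until the second is exhausted: dropping on lists, truncated
    subtraction on unary numbers. Indexing, equality and comparison all rest on it. *)
Definition hdrop : hexpr :=
  HHd (HIter 2
    (HIf (HTl (HHd HArg))
         (HNode (HTl (HHd (HHd HArg))) (HTl (HTl (HHd HArg))))
         (HHd HArg))
    HArg).

Definition hdiff a b := HApp hdrop (HNode a b).
Definition hnth l k := HHd (hdiff l k).
Definition heq a b := hand (hnot (hdiff a b)) (hnot (hdiff b a)).
Definition hadj a b := hnth (hnth HGlob a) b.
Definition hadjr a b := hor (heq a b) (hadj a b).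

Lemma den_hdiff g x a b :
  spine (den g x b) <= spine g ->
  den g x (hdiff a b) = iter (spine (den g x b)) tree_tl (den g x a).
Proof.
rewrite /=; move: (den g x a) (den g x b) => l k.
elim: (spine g) l k => [|N IHN] l k; first by case: k.
rewrite iterSr; case: k => [|k1 k] /= lekN; last by rewrite IHN // -iterSr.
exact: (IHN l Leaf).
Qed.

Lemma is_node_iter_tl k l : is_node (iter k tree_tl l) = (k < spine l).
Proof.
by elim: k l => [|k IHk] [|l1 l] //; rewrite iterSr IHk.
Qed.

Lemma nth_enc_seq s k : tree_hd (iter k tree_tl (enc_seq s)) = nth Leaf s k.
Proof.
elim: k s => [|k IHk] [|t s] //; rewrite iterSr; last exact: IHk.
by rewrite -[RHS](nth_nil Leaf k) -IHk.
Qed.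

Lemma spine_enc_seq s : spine (enc_seq s) = size s.
Proof. by elim: s => //= t s ->. Qed.

(* Any tree with right spine of length i may stand for the number i; as loop   *)
(* counters serve the suffixes of the global list.                             *)
Definition num (g : tree) (i : nat) : tree := iter (spine g - i) tree_tl g.

Lemma spine_num g i : i <= spine g -> spine (num g i) = i.
Proof.
move=> leig; have E k : spine (iter k tree_tl g) = spine g - k.
  elim: k => [|k IHk]; first by rewrite subn0.
  by rewrite iterS subnS -IHk; case: (iter _ _ _).
by rewrite /num E subKn.
Qed.

(** The counter starts as the global list and [step] sees its tail, so the indices run down to 0,
    the order of a right fold. [step] receives index, accumulator and argument, nested to the
    right. *)
Definition hloop (k : nat) (init step : hexpr) : hexpr :=
  let i := HTl (HHd (HHd HArg)) in
  HTl (HIter k (HNode i (HApp step (HNode i (HNode (HTl (HHd HArg)) (HTl HArg)))))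
         (HNode HGlob init)).

Lemma den_hloop g x k init step :
  den g x (hloop k init step) =
  foldr (fun i r => den g (Node (num g i) (Node r x)) step) (den g x init)
    (iota 0 (spine g)).
Proof.
rewrite /=; set F := (X in foldr X); set B := (X in iter _ X).
suff H j : j <= spine g -> iter j B (Node g (den g x init)) =
    Node (num g (spine g - j))
         (foldr F (den g x init) (iota (spine g - j) j)).
  by rewrite H // subnn.
elim: j => [|j IHj] ltjg; first by rewrite /num subn0 subnn.
rewrite iterS IHj 1?ltnW // /B /= [iota _ _]/= -/(iota _ _).
have -> : tree_tl (num g (spine g - j)) = num g (spine g - j.+1).
  by rewrite /num !subKn // ltnW.
by rewrite (_ : (spine g - j.+1).+1 = spine g - j) // subnS prednK // subn_gt0.
Qed.

Definition hsome k p :=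
  hloop k HLeaf (HIf (HApp p (HNode (HHd HArg) (HTl (HTl HArg)))) htrue
                     (HHd (HTl HArg))).
(** A hit is wrapped in a Node because the index 0 is itself the tree Leaf. *)
Definition hfind k p :=
  hloop k HLeaf (HIf (HApp p (HNode (HHd HArg) (HTl (HTl HArg))))
                     (HNode HLeaf (HHd HArg)) (HHd (HTl HArg))).
Definition hcount k p :=
  hloop k HLeaf (HIf (HApp p (HNode (HHd HArg) (HTl (HTl HArg))))
                     (HNode HLeaf (HHd (HTl HArg))) (HHd (HTl HArg))).
Definition hmap k e :=
  hloop k HLeaf (HNode (HApp e (HNode (HHd HArg) (HTl (HTl HArg))))
                       (HHd (HTl HArg))).

Section Loops.
Variables (n : nat) (g x : tree).
Hypothesis spine_g : spine g = n.

Lemma den_hloop_ord k init step :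
  den g x (hloop k init step) =
  foldr (fun (i : 'I_n) r => den g (Node (num g i) (Node r x)) step)
    (den g x init) (enum 'I_n).
Proof. by rewrite den_hloop spine_g -val_enum_ord foldr_map. Qed.

Section Pred.
Variables (p : hexpr) (Q : pred 'I_n).
Hypothesis pQ : forall i : 'I_n, is_node (den g (Node (num g i) x) p) = Q i.

Lemma den_hsome k : den g x (hsome k p) = enc_bool [exists i, Q i].
Proof.
rewrite den_hloop_ord /=.
have -> : [exists i, Q i] = has Q (enum 'I_n).
  apply/existsP/hasP => [[i Qi] | [i _ Qi]]; exists i => //.
  by rewrite mem_enum.
by elim: (enum _) => //= i s ->; rewrite pQ; case: (Q i).
Qed.

Lemma den_hfind k :
  exists o : option 'I_n,
    den g x (hfind k p) = (if o is Some i then Node Leaf (num g i) else Leaf) /\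
    (if o is Some i then Q i else forall i, ~~ Q i).
Proof.
rewrite den_hloop_ord /=.
have : exists (o : option 'I_n),
   foldr (fun (i : 'I_n) r => if is_node (den g (Node (num g i) x) p)
                   then Node Leaf (num g i) else r) Leaf (enum 'I_n) =
   (if o is Some i then Node Leaf (num g i) else Leaf) /\
   (if o is Some i then Q i else forall i, i \in enum 'I_n -> ~~ Q i).
  elim: (enum _) => [|i s [o [Eo Ho]]]; first by exists None.
  rewrite /= pQ; case: ifPn => Qi; first by exists (Some i).
  exists o; split=> //; case: o Ho {Eo} => // Ho j; rewrite inE => /predU1P[->|] //.
  exact: Ho.
move=> [o [Eo Ho]]; exists o; split=> //.
by case: o Ho {Eo} => // Ho i; apply: Ho; rewrite mem_enum.
Qed.

Lemma den_hcount k : spine (den g x (hcount k p)) = #|[set i | Q i]|.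
Proof.
rewrite den_hloop_ord /= enumT cardsE cardE /enum_mem size_filter.
by elim: (Finite.enum _) => //= i s <-; rewrite pQ unfold_in; case: (Q i).
Qed.

End Pred.

Lemma den_hmap k e (F : 'I_n -> tree) :
  (forall i : 'I_n, den g (Node (num g i) x) e = F i) ->
  den g x (hmap k e) = enc_seq [seq F i | i <- enum 'I_n].
Proof.
move=> eF; rewrite den_hloop_ord /=.
by elim: (enum _) => //= i s ->; rewrite eF.
Qed.

End Loops.

Section Access.
Variables (n : nat) (G : graph 'I_n).
Local Notation g := (enc_graph G).

Lemma spine_enc_graph : spine g = n.
Proof. by rewrite spine_enc_seq size_map size_enum_ord. Qed.

Lemma nth_map_ord (F : 'I_n -> tree) (i : 'I_n) :
  nth Leaf [seq F j | j <- enum 'I_n] i = F i.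
Proof. by rewrite (nth_map i) ?size_enum_ord ?nth_ord_enum. Qed.

Lemma spine_ord (i : 'I_n) : spine (num g i) = i.
Proof. by rewrite spine_num // spine_enc_graph ltnW. Qed.

Section At.
Variables (x : tree) (a b l : hexpr) (i j : 'I_n) (F : 'I_n -> tree).
Hypotheses (ai : den g x a = num g i) (bj : den g x b = num g j).
Hypothesis (lF : den g x l = enc_seq [seq F j | j <- enum 'I_n]).

Lemma den_hnth : den g x (hnth l a) = F i.
Proof.
rewrite -[LHS]/(tree_hd (den g x (hdiff l a))).
by rewrite den_hdiff ai spine_ord ?lF ?nth_enc_seq ?nth_map_ord //
           spine_enc_graph ltnW.
Qed.

Lemma den_heq : is_node (den g x (heq a b)) = (i == j).
Proof.
rewrite den_hand !den_hnot !den_hdiff ?ai ?bj ?spine_ord //;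
  rewrite ?spine_enc_graph 1?ltnW //.
by rewrite !is_node_iter_tl !spine_ord -!leqNgt -eqn_leq.
Qed.

End At.

Lemma den_hadj x a b (i j : 'I_n) :
  den g x a = num g i -> den g x b = num g j ->
  den g x (hadj a b) = enc_bool (G i j).
Proof.
move=> ai bj; apply: (den_hnth (F := fun j => enc_bool (G i j)) bj).
exact: (@den_hnth _ _ _ _ (fun i => enc_seq [seq enc_bool (G i j) | j <- enum 'I_n])).
Qed.

Lemma den_hadjr x a b (i j : 'I_n) :
  den g x a = num g i -> den g x b = num g j ->
  is_node (den g x (hadjr a b)) = adjr G i j.
Proof.
by move=> ai bj; rewrite den_hor (den_heq ai bj) (den_hadj ai bj) is_node_enc_bool.
Qed.

End Access.

(** * Propagation and the choice of the branching vertex *)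

(* Head and tail of a label tell whether the vertex is in the cluster part or  *)
(* in the independent part.                                                    *)
Definition enc_label (o : option bool) : tree :=
  if o is Some c then Node (enc_bool (~~ c)) (enc_bool c) else Leaf.

Definition hlabelI := HNode HLeaf htrue.
Definition hlabelC := HNode htrue HLeaf.

(** Each enclosing loop puts its index in front of the argument, so vertices are addressed like de
    Bruijn indices, with the labels innermost. *)
Definition hforcedC :=
  hsome 3 (hand (hadj (HHd (HTl HArg)) (HHd HArg))
                (HTl (hnth (HTl (HTl HArg)) (HHd HArg)))).

Definition hforcedI :=
  let b := HHd HArg in
  let a := HHd (HTl HArg) in
  let v := HHd (HTl (HTl HArg)) in
  let L := HTl (HTl (HTl HArg)) in
  hsome 4 (hsome 5
    (hand (HHd (hnth L a)) (hand (HHd (hnth L b))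
       (hand (hadj v a) (hxor (hadjr a b) (hadjr v b)))))).

Definition hbad :=
  let label := hnth (HTl HArg) (HHd HArg) in
  hor (hand hforcedC (hnot (HHd label))) (hand hforcedI (hnot (HTl label))).

Definition hset v c L :=
  HApp (hmap 6 (HIf (heq (HHd HArg) (HHd (HHd (HTl HArg))))
                    (HTl (HHd (HTl HArg)))
                    (hnth (HTl (HTl HArg)) (HHd HArg))))
       (HNode (HNode v c) L).

Definition hassign_forced :=
  let v := HTl (HHd HArg) in
  let L := HTl HArg in
  let c := HIf (HApp hforcedC (HNode v L)) hlabelC hlabelI in
  HIf (HHd HArg)
      (HIf (hnth L v) HLeaf (HNode HLeaf (hset v c L)))
      (HNode HLeaf L).

Definition hpropagate1 :=
  HIf HArg
      (HApp hassign_forced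
         (HNode (HApp (hfind 7 hbad) (HTl HArg)) (HTl HArg)))
      HLeaf.

(** After n rounds without a fixed point every vertex is decided, but a conflict may still be
    unnoticed; the extra round detects it. *)
Definition hpropagate :=
  HApp hpropagate1 (HIter 8 (HApp hpropagate1 (HHd HArg)) (HNode HLeaf HArg)).

Definition hdeg :=
  hcount 9 (hand (hadj (HHd (HTl HArg)) (HHd HArg))
                 (hnot (hnth (HTl (HTl HArg)) (HHd HArg)))).

Definition hmaxdeg :=
  let u := HHd HArg in
  let v := HHd (HTl HArg) in
  let L := HTl (HTl HArg) in
  hfind 10 (hand (hnot (hnth (HTl HArg) (HHd HArg)))
                 (hnot (hsome 11 (hand (hnot (hnth L u))
                                       (hdiff (HApp hdeg (HNode u L))
                                              (HApp hdeg (HNode v L))))))).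

Definition hanswer :=
  HNode (hmap 12 (HHd (hnth (HTl HArg) (HHd HArg))))
        (hmap 13 (HTl (hnth (HTl HArg) (HHd HArg)))).

(** The tail of the unary degree is a Node from degree 2 on. For smaller degrees, the outcome of
    propagating [v] in I selects the single labelling to continue with. *)
Definition hbranch :=
  let v := HHd HArg in
  let L := HTl HArg in
  HIf (HTl (HApp hdeg HArg))
      (HNode (HNode (HNode HLeaf (hset v hlabelI L)) HLeaf) (hset v hlabelC L))
      (HNode htrue
         (HApp (HIf (HHd HArg) (HTl (HHd HArg)) (HTl HArg))
               (HNode (HApp hpropagate (hset v hlabelI L)) (hset v hlabelC L)))).

(* The result is Leaf if the labels admit no extension, a Node with head Leaf  *)
(* and tail the answer if all vertices are decided, and otherwise a Node whose *)
(* tail, and optionally the tail of the head of its head, are labels to which  *)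
(* the problem is reduced.                                                     *)
Definition hplan :=
  HApp (HIf HArg
          (HApp (HIf (HHd HArg)
                     (HApp hbranch (HNode (HTl (HHd HArg)) (HTl HArg)))
                     (HNode HLeaf (HApp hanswer (HTl HArg))))
                (HNode (HApp hmaxdeg (HTl HArg)) (HTl HArg)))
          HLeaf)
       hpropagate.

Section Unfold.
Variables (g x : tree).

Lemma den_node a b : den g x (HNode a b) = Node (den g x a) (den g x b).
Proof. by []. Qed.

Lemma den_hd a : den g x (HHd a) = tree_hd (den g x a).
Proof. by []. Qed.

Lemma den_tl a : den g x (HTl a) = tree_tl (den g x a).
Proof. by []. Qed.

Lemma den_if a b c :
  den g x (HIf a b c) = if is_node (den g x a) then den g x b else den g x c.
Proof. by []. Qed.

Lemma den_app f a : den g x (HApp f a) = den g (den g x a) f.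
Proof. by []. Qed.

End Unfold.

(** * Meaning of the expressions on encoded labellings *)

Section Specification.
Variables (n : nat) (G : graph 'I_n).
Local Notation g := (enc_graph G).
Implicit Types (L : {ffun 'I_n -> option bool}) (v : 'I_n).

Definition enc_labels L : tree := enc_seq [seq enc_label (L i) | i <- enum 'I_n].

Lemma is_node_enc_label o : is_node (enc_label o) = (o != None).
Proof. by case: o. Qed.

Lemma is_node_label_hd o : is_node (tree_hd (enc_label o)) = (o == Some false).
Proof. by case: o => [[]|]. Qed.

Lemma is_node_label_tl o : is_node (tree_tl (enc_label o)) = (o == Some true).
Proof. by case: o => [[]|]. Qed.

Lemma den_label x l a L v :
  den g x l = enc_labels L -> den g x a = num g v ->
  den g x (hnth l a) = enc_label (L v).
Proof. by move=> lL av; apply: (den_hnth (F := fun i => enc_label (L i))). Qed.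

Lemma den_hforcedC L v :
  den g (Node (num g v) (enc_labels L)) hforcedC = enc_bool (forcedC G L v).
Proof.
apply: den_hsome => [|u]; first exact: spine_enc_graph.
rewrite den_hand (@den_hadj _ _ _ _ _ v u) // is_node_enc_bool; congr (_ && _).
rewrite den_tl -is_node_label_tl.
by rewrite (@den_label _ _ _ L u).
Qed.

Lemma den_hforcedI L v :
  den g (Node (num g v) (enc_labels L)) hforcedI = enc_bool (forcedI G L v).
Proof.
apply: den_hsome => [|a]; first exact: spine_enc_graph.
rewrite (@den_hsome n _ _ _ _
  [pred b | [&& L a == Some false, L b == Some false & p3 G v a b]]).
- by rewrite is_node_enc_bool.
- exact: spine_enc_graph.
move=> b; rewrite [RHS]/= !den_hand den_hxor (@den_hadj _ _ _ _ _ v a) //.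
rewrite (@den_hadjr _ _ _ _ _ a b) // (@den_hadjr _ _ _ _ _ v b) //.
rewrite is_node_enc_bool -!is_node_label_hd.
congr [&& is_node _, is_node _ & _].
- by rewrite den_hd (@den_label _ _ _ L a).
- by rewrite den_hd (@den_label _ _ _ L b).
Qed.

Lemma den_hbad L v :
  is_node (den g (Node (num g v) (enc_labels L)) hbad) = bad G L v.
Proof.
rewrite den_hor !den_hand !den_hnot den_hforcedC den_hforcedI !is_node_enc_bool.
rewrite /bad -is_node_label_hd -is_node_label_tl.
by rewrite den_hd den_tl (@den_label _ _ _ L v).
Qed.

Lemma den_hset x a c l v b L :
  den g x a = num g v -> den g x c = enc_label (Some b) ->
  den g x l = enc_labels L ->
  den g x (hset a c l) = enc_labels (setl L v b).
Proof.
move=> av cb lL; rewrite den_app !den_node av cb lL.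
apply: den_hmap => [|i]; first exact: spine_enc_graph.
rewrite ffunE den_if (@den_heq _ _ _ _ _ i v) //; case: ifP => // _.
exact: den_label.
Qed.

Definition enc_state (o : option {ffun 'I_n -> option bool}) : tree :=
  if o is Some L then Node Leaf (enc_labels L) else Leaf.

Lemma den_hpropagate1 L : exists o,
  den g (enc_state (Some L)) hpropagate1 = enc_state o /\
  match o with
  | None => ~ solvable G L
  | Some L' => [/\ refines L' L, (solvable G L -> solvable G L') &
      (L' = L /\ propagated G L) \/ (~ propagated G L /\ undecided L' \proper undecided L)]
  end.
Proof.
have [f [Ef Hf]] := @den_hfind n g (enc_labels L) (spine_enc_graph G) hbad
  (bad G L) (den_hbad L) 7.
have -> : den g (enc_state (Some L)) hpropagate1 =
    den g (Node (den g (enc_labels L) (hfind 7 hbad)) (enc_labels L)) hassign_forced.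
  by [].
rewrite {}Ef; case: f Hf => [v badv | propL]; last first.
  by exists (Some L); split=> //; split=> //; left.
set x := Node _ _; rewrite /hassign_forced.
set e := hset _ _ _.
set l := hnth _ _; set d := HIf l _ _.
have -> : den g x (HIf (HHd HArg) d (HNode HLeaf (HTl HArg))) =
    if is_node (den g x l) then Leaf else Node Leaf (den g x e) by [].
rewrite (@den_label _ _ _ L v) // is_node_enc_label.
case: (L v =P None) => Lv; last first.
  by exists None; split=> // -[t vt /(bad_sound vt)/(_ badv)[]].
exists (Some (setl L v (~~ forcedC G L v))); split.
  rewrite -[LHS]/(Node Leaf (den g x e)) /e (@den_hset _ _ _ _ v (~~ forcedC G L v) L) //.
  rewrite den_if den_app den_node den_hforcedC is_node_enc_bool; by case: (forcedC G L v).
split; first exact: refines_setl.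
  by move=> [t vt et]; exists t => //; have [] := bad_sound vt et badv.
right; split; first by move/(_ v); rewrite badv.
apply/properP; split.
  by apply/subsetP=> u; rewrite !inE ffunE; case: (u == v).
by exists v; rewrite !inE ?ffunE ?Lv ?eqxx.
Qed.

Lemma den_hpropagate L : exists o,
  den g (enc_labels L) hpropagate = enc_state o /\
  match o with
  | None => ~ solvable G L
  | Some L' => [/\ refines L' L, (solvable G L -> solvable G L') & propagated G L']
  end.
Proof.
pose f := (fun s => den g (Node s (enc_labels L)) (HApp hpropagate1 (HHd HArg))).
rewrite -[den _ _ _]/(den g (iter (spine g) f (Node Leaf (enc_labels L))) hpropagate1).
have step o : f (enc_state o) = den g (enc_state o) hpropagate1 by [].
(* Invariant: as long as no fixed point is reached, every round has decided at least one vertex. *)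
have [o [-> Ho]] : exists o, iter (spine g) f (enc_state (Some L)) = enc_state o /\
   match o with
   | None => ~ solvable G L
   | Some L' => [/\ refines L' L, (solvable G L -> solvable G L') &
       propagated G L' \/ #|undecided L'| + spine g <= n]
   end.
  elim: (spine g) => [|k [[L'|] [Ek Hk]]].
  - exists (Some L); split=> //; split=> //; right.
    by rewrite addn0 -[X in _ <= X]card_ord max_card.
  - have [o [Eo Ho]] := den_hpropagate1 L'; exists o.
    rewrite iterS Ek step Eo; split=> //; case: o Ho {Eo} => [L''|]; last first.
      by case: Hk => _ sol _ nsol /sol.
    case: Hk => ref sol cl [ref' sol' cl']; split; first exact: refines_trans ref'.
      by move/sol/sol'.
    case: cl cl' => [cl | lek] [[-> cl'] | [ncl /proper_card lt]] //; try by left.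
    by right; apply: leq_trans lek; rewrite addnS -addSn leq_add2r.
  - by exists None; rewrite iterS Ek step.
case: o Ho => [L'|]; last by exists None.
case=> ref sol pd; have [o [-> Ho]] := den_hpropagate1 L'; exists o; split=> //.
case: o Ho => [L''|]; last by move=> nsol /sol.
case=> ref' sol' pd'; split; first exact: refines_trans ref'.
  by move/sol/sol'.
(* If the last round still found a bad vertex, it would shrink an undecided set that is already
   empty. *)
case: pd' pd => [[-> //] | [npd /proper_card lt]] [// | ].
by rewrite spine_enc_graph; lia.
Qed.

Lemma den_hdeg L v :
  spine (den g (Node (num g v) (enc_labels L)) hdeg) = deg G (undecided L) v.
Proof.
rewrite (@den_hcount n _ _ (spine_enc_graph G) _
           [pred u | (L u == None) && G v u]) => [|u].
  by apply: eq_card => u; rewrite !inE.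
rewrite den_hand den_hnot (@den_hadj _ _ _ _ _ v u) // (@den_label _ _ _ L u) //.
by rewrite is_node_enc_bool is_node_enc_label negbK andbC.
Qed.

Lemma den_hmaxdeg L : exists o : option 'I_n,
  den g (enc_labels L) hmaxdeg = (if o is Some i then Node Leaf (num g i) else Leaf) /\
  if o is Some v
  then v \in undecided L /\
       {in undecided L, forall u, deg G (undecided L) u <= deg G (undecided L) v}
  else undecided L = set0.
Proof.
set U := undecided L.
pose Q v := (v \in U) && ~~ [exists u, (u \in U) && (deg G U v < deg G U u)].
rewrite /hmaxdeg; set p := (X in hfind 10 X).
have pQ v : is_node (den g (Node (num g v) (enc_labels L)) p) = Q v.
  rewrite den_hand !den_hnot (@den_label _ _ _ L v) // is_node_enc_label negbK.
  congr (_ && ~~ _); first by rewrite inE.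
  rewrite (@den_hsome n _ _ (spine_enc_graph G) _
             [pred u | (u \in U) && (deg G U v < deg G U u)]) => [|u].
    by rewrite is_node_enc_bool.
  rewrite den_hand den_hnot (@den_label _ _ _ L u) // is_node_enc_label negbK.
  rewrite [RHS]/= inE; congr (_ && _).
  rewrite den_hdiff !den_app !den_node (den_hdeg L).
    by rewrite is_node_iter_tl (den_hdeg L).
  by rewrite spine_enc_graph -[X in _ <= X]card_ord max_card.
have [o [Eo Qo]] := den_hfind (spine_enc_graph G) pQ 10.
exists o; split=> //; case: o Qo {Eo} => [v /andP[vU /existsPn maxv] | nQ].
  by split=> // u uU; rewrite leqNgt; have := maxv u; rewrite uU.
apply/eqP; apply: contraT => /set0Pn[v0 v0U].
case: (arg_maxnP (deg G U) v0U) => v vU maxv.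
have := nQ v; rewrite /Q [v \in U]vU /= negbK => /existsP[u /andP[uU]].
by rewrite ltnNge [_ <= _]maxv.
Qed.

Lemma den_hanswer L :
  den g (enc_labels L) hanswer =
  Node (enc_seq [seq enc_bool (L v == Some false) | v <- enum 'I_n])
       (enc_seq [seq enc_bool (L v == Some true) | v <- enum 'I_n]).
Proof.
rewrite /hanswer den_node.
rewrite (@den_hmap n _ _ _ _ _ (fun v => enc_bool (L v == Some false))).
- congr Node; apply: den_hmap => [|v]; first exact: spine_enc_graph.
  by rewrite den_tl (@den_label _ _ _ L v) //; case: (L v) => [[]|].
- exact: spine_enc_graph.
- by move=> v; rewrite den_hd (@den_label _ _ _ L v) //; case: (L v) => [[]|].
Qed.

(** [U] stands for the vertices undecided after propagation. Degrees are taken in it, while the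
    measure of the call is that of the larger set [residual G L]. *)
Variant plan_spec L : tree -> Prop :=
  | PlanFail of ~ solvable G L : plan_spec L Leaf
  | PlanDone (C I : {set 'I_n}) of monopolar_partition G C I :
      plan_spec L (Node Leaf (Node (enc_set C) (enc_set I)))
  | PlanChain L1 (U : {set 'I_n}) of U \subset residual G L
      & residual G L1 \proper U & (solvable G L -> solvable G L1) :
      plan_spec L (Node (Node Leaf Leaf) (enc_labels L1))
  | PlanBranch L1 L2 (U : {set 'I_n}) v of U \subset residual G L
      & v \in U & 1 < deg G U v & {in U, forall u, deg G U u <= deg G U v}
      & residual G L1 \subset U :\: (v |: [set u in U | G v u])
      & residual G L2 \subset U :\ v
      & (solvable G L -> solvable G L1 \/ solvable G L2) :
      plan_spec L (Node (Node (Node Leaf (enc_labels L1)) Leaf) (enc_labels L2)).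

Lemma den_hbranch L v :
  den g (Node (num g v) (enc_labels L)) hbranch =
  if 1 < deg G (undecided L) v
  then Node (Node (Node Leaf (enc_labels (setl L v true))) Leaf)
            (enc_labels (setl L v false))
  else Node (Node Leaf Leaf)
    (let r := den g (enc_labels (setl L v true)) hpropagate in
     if is_node r then tree_tl r else enc_labels (setl L v false)).
Proof.
set x := Node _ _; rewrite /hbranch.
set LI := hset _ hlabelI _; set LC := hset _ hlabelC _.
have -> : enc_labels (setl L v true) = den g x LI by rewrite (@den_hset _ _ _ _ v true L).
have -> : enc_labels (setl L v false) = den g x LC by rewrite (@den_hset _ _ _ _ v false L).
rewrite -(den_hdeg L v) -/x.
by rewrite -[1 < _](is_node_iter_tl 1 (den g x hdeg)).
Qed.

Lemma den_hplan L : plan_spec L (den g (enc_labels L) hplan).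
Proof.
pose select l m :=
  if is_node m then den g (Node (tree_tl m) l) hbranch
  else Node Leaf (den g l hanswer).
pose reduce r :=
  if is_node r then select (tree_tl r) (den g (tree_tl r) hmaxdeg) else Leaf.
have -> : den g (enc_labels L) hplan = reduce (den g (enc_labels L) hpropagate).
  by [].
have [[L'|] [-> HL']] := den_hpropagate L; last exact: PlanFail.
case: HL' => ref sol propL'.
rewrite -[reduce _]/(select (enc_labels L') (den g (enc_labels L') hmaxdeg)).
have [[v|] [-> Hv]] := den_hmaxdeg L'; last first.
  rewrite /select /is_node den_hanswer.
  have /validP := propagated_valid propL' Hv.
  set C := [set v | ~~ _]; set I := [set v | _] => part.
  suff [-> ->] : enc_seq [seq enc_bool (L' v == Some false) | v <- enum 'I_n] = enc_set C
      /\ enc_seq [seq enc_bool (L' v == Some true) | v <- enum 'I_n] = enc_set I.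
    exact: PlanDone.
  split; congr enc_seq; apply: eq_map => v; rewrite inE ffunE //.
  by have /setP/(_ v) := Hv; rewrite !inE; case: (L' v) => [[]|].
case: Hv => vU maxv; rewrite /select [is_node _]/= [tree_tl _]/= den_hbranch.
have subU := undecided_residual ref propL'.
case: ltnP => degv.
  apply: (PlanBranch subU vU degv maxv).
  - exact: residual_setl_true.
  - exact: residual_setl_false.
  - by move/sol; apply: solvable_branch.
have Lv : L' v = None by move: vU; rewrite inE => /eqP.
(* All undecided degrees are at most 1 here. A failed trial of [v] in I forces [v] into C; a
   successful one is kept by [solvable_refines]. *)
have [[L1|] [-> HL1]] := den_hpropagate (setl L' v true); last first.
  apply: (PlanChain subU).
    exact: sub_proper_trans (residual_setl_false _ _ _) (properD1 vU).
  by move/sol/solvable_branch => /(_ v)[].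
case: HL1 => ref1 _ prop1; rewrite [X in Node _ X]/=; apply: (PlanChain subU).
  have sub1 : residual G L1 \subset undecided L1.
    by apply/subsetP=> u; rewrite inE => /andP[].
  apply: sub_proper_trans (properD1 vU).
  apply: subset_trans (subset_trans sub1 (undecided_residual ref1 prop1)) _.
  apply: subset_trans (residual_setl_true _ _ _) _.
  by apply/subsetP=> u; rewrite !inE negb_or => /andP[/andP[-> _]].
move/sol; apply: solvable_refines => //.
  by move=> u /maxv/leq_trans; apply.
exact: refines_trans (refines_setl true Lv) ref1.
Qed.

End Specification.

(** * The measure *)

Definition weight (d : nat) : nat := nth 26 [:: 0; 16; 25] d.

Lemma leq_weight : {homo weight : d e / d <= e}.
Proof. by case=> [|[|[|d]]] [|[|[|e]]]; rewrite /weight //= !nth_nil. Qed.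

Section Measure.
Variables (T : finType) (G : graph T).
Implicit Types (U V : {set T}) (u v : T).

Definition measure U : nat := \sum_(u in U) weight (deg G U u).

Lemma leq_deg U V u : V \subset U -> deg G V u <= deg G U u.
Proof.
move=> sVU; apply/subset_leq_card/subsetP=> x; rewrite !inE => /andP[xV ->].
by rewrite (subsetP sVU).
Qed.

Lemma measure_split U V : V \subset U ->
  measure U = \sum_(u in V) weight (deg G U u) +
              \sum_(u in U :\: V) weight (deg G U u).
Proof. by move=> sVU; rewrite /measure (big_setID V) /= (setIidPr sVU). Qed.

Lemma leq_measure U V : V \subset U -> measure V <= measure U.
Proof.
move=> sVU; rewrite (measure_split sVU); apply: leq_trans (leq_addr _ _).
by apply: leq_sum => u _; apply/leq_weight/leq_deg.
Qed.

Section Branch.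
Variables (U : {set T}) (v : T).
Hypothesis vU : v \in U.
Let N := [set u in U | G v u].

Lemma measure_closed_nbhd V : V \subset U :\: (v |: N) ->
  measure V + (weight (deg G U v) + \sum_(u in N) weight (deg G U u))
    <= measure U.
Proof.
move=> sV; have sN : v |: N \subset U.
  by rewrite subUset sub1set vU; apply/subsetP=> u; rewrite inE => /andP[].
rewrite (measure_split sN) big_setU1 /=; last by rewrite inE adj_irr andbF.
rewrite addnC leq_add2l; apply: leq_trans (leq_measure sV) _.
by apply: leq_sum => u _; apply/leq_weight/leq_deg; apply: subsetDl.
Qed.

(** Deleting [v] costs each neighbour exactly one degree, hence the corresponding drop of weight. *)
Lemma measure_vertex V : V \subset U :\ v ->
  measure V +
    (weight (deg G U v) +
     \sum_(u in N) (weight (deg G U u) - weight (deg G U u).-1)) <= measure U.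
Proof.
move=> sV; apply: leq_trans (leq_add (leq_measure sV) (leqnn _)) _.
rewrite addnCA /measure [X in _ <= X](big_setD1 v) //= leq_add2l.
have vN : N \subset U :\ v.
  apply/subsetP=> u; rewrite !inE => /andP[-> vu]; rewrite andbT.
  by apply: contraTneq vu => ->; rewrite adj_irr.
rewrite (big_setID N) [X in _ <= X](big_setID N) /= (setIidPr vN).
rewrite addnAC -big_split /= leq_add //; last first.
  by apply: leq_sum => u _; apply/leq_weight/leq_deg/subsetDl.
apply: leq_sum => u; rewrite inE => /andP[uU vu].
have -> : deg G U u = (deg G (U :\ v) u).+1.
  rewrite /deg (cardsD1 v) inE vU adj_sym vu; congr _.+1.
  by apply: eq_card => x; rewrite !inE andbA.
by rewrite subnKC // leq_weight.
Qed.

End Branch.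
End Measure.

(** * Branching vectors and the growth rate *)

Local Open Scope ring_scope.

(* Weight losses in the branches v in C and v in I, where v has degree 2, 3 or *)
(* more, according to the number of neighbours of degree 1 (first row) or at   *)
(* most 2 (other rows).                                                        *)
Definition branchings : seq (nat * nat) :=
  [:: (43, 75); (50, 66); (57, 57);
      (29, 104); (37, 94); (45, 84); (53, 74);
      (26, 130); (35, 120); (44, 110); (53, 100); (62, 90)]%N.

Definition branching_rate (r : rat) : Prop :=
  1 <= r /\ forall c s, (c, s) \in branchings -> r ^- c + r ^- s <= 1.

(** At r = 165/163 the power [r ^+ 26] is about 1.3731, and the tightest pair is (57, 57). *)
Lemma branching_rate_exists :
  exists2 r : rat, branching_rate r & r ^+ 26 <= 13734%:R / 10000%:R.
Proof.
have [r rE] : exists r : rat, r = 165%:R / 163%:R by eexists.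
exists r; last by rewrite rE; lra.
split=> [|c s cs]; first by rewrite rE; lra.
have rV : r^-1 = 163%:R / 165%:R by rewrite rE invf_div.
rewrite -[r ^- c]exprVn -[r ^- s]exprVn rV.
move: cs {rV rE}; rewrite /branchings !in_cons.
by do 12![case/predU1P => [[-> ->] | ]; first lra].
Qed.

Local Close Scope ring_scope.

Section Sums.
Variables (T : finType) (N : {set T}) (F : T -> nat) (P : pred T) (a b : nat).

Lemma leq_sum_affine :
  (forall u, u \in N -> a + b * P u <= F u) ->
  #|N| * a + b * \sum_(u in N) P u <= \sum_(u in N) F u.
Proof.
by move=> le; rewrite -sum_nat_const big_distrr -big_split; apply: leq_sum.
Qed.

Lemma leq_affine_sum :
  (forall u, u \in N -> a <= F u + b * P u) ->
  #|N| * a <= \sum_(u in N) F u + b * \sum_(u in N) P u.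
Proof.
by move=> le; rewrite -sum_nat_const big_distrr -big_split; apply: leq_sum.
Qed.

End Sums.

(** [f] gives the degrees of the neighbours: positive because of the branching vertex, at most its
    degree by maximality. Each neighbour's loss is bounded below affinely in the indicator [P] of
    low degree, so only the number [K P] of such neighbours matters. *)
Lemma branching_cover (T : finType) (N : {set T}) (f : T -> nat) :
  1 < #|N| -> {in N, forall u, 0 < f u <= #|N|} ->
  exists c s, [/\ (c, s) \in branchings,
    c <= weight #|N| + \sum_(u in N) (weight (f u) - weight (f u).-1) &
    s <= weight #|N| + \sum_(u in N) weight (f u)].
Proof.
set C := \sum_(u in N) _; set S := \sum_(u in N) weight (f u).
pose K (P : pred T) := \sum_(u in N) P u.
have leK P : K P <= #|N|.
  by rewrite -sum1_card; apply: leq_sum => u _; case: (P u).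
move=> N1 fN; have [d2|d2] := eqVneq #|N| 2.
  pose P u := f u == 1.
  (* The weight drops by 16 from degree 1 and by 9 from degree 2. *)
  have lC : #|N| * 9 + 7 * K P <= C.
    apply: leq_sum_affine => u /fN; rewrite d2 /P.
    by case: (f u) => [|[|[|?]]].
  have lS : #|N| * 25 <= S + 9 * K P.
    apply: leq_affine_sum => u /fN; rewrite d2 /P.
    by case: (f u) => [|[|[|?]]].
  have := leK P; move: lC lS; rewrite d2 -[weight 2]/25.
  case: (K P) => [|[|[|k]]] // lC lS _.
  - by exists 43, 75; split=> //; lia.
  - by exists 50, 66; split=> //; lia.
  - by exists 57, 57; split=> //; lia.
pose P u := f u <= 2.
have lS : #|N| * 26 <= S + 10 * K P.
  apply: leq_affine_sum => u /fN; rewrite /P.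
  by case: (f u) => [|[|[|?]]] //=; rewrite /weight /= nth_nil.
have [d3|d3] := eqVneq #|N| 3.
  (* The weight drops by 26 - 25 = 1 from degree 3 and by at least 9 from lower degrees. *)
  have lC : #|N| * 1 + 8 * K P <= C.
    apply: leq_sum_affine => u /fN; rewrite d3 /P.
    by case: (f u) => [|[|[|[|?]]]].
  have := leK P; move: lC lS; rewrite d3 -[weight 3]/26.
  case: (K P) => [|[|[|[|k]]]] // lC lS _.
  - by exists 29, 104; split=> //; lia.
  - by exists 37, 94; split=> //; lia.
  - by exists 45, 84; split=> //; lia.
  - by exists 53, 74; split=> //; lia.
have lC : #|N| * 0 + 9 * K P <= C.
  by apply: leq_sum_affine => u /fN; rewrite /P; case: (f u) => [|[|[|?]]].
(* Serves the case of four or more low-degree neighbours, where s = 26 + 4 * 16 = 90. *)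
have lS' : #|N| * 16 + 0 * K P <= S.
  apply: leq_sum_affine => u /fN.
  by case: (f u) => [|[|[|?]]] //= _; rewrite /weight /= nth_nil.
have -> : weight #|N| = 26.
  by move: N1 d2 d3; case: #|N| => [|[|[|[|?]]]] //; rewrite /weight /= nth_nil.
have N4 : 4 <= #|N| by move: N1 d2 d3; lia.
case: (K P) lC lS => [|[|[|[|k]]]] lC lS.
- by exists 26, 130; split=> //; lia.
- by exists 35, 120; split=> //; lia.
- by exists 44, 110; split=> //; lia.
- by exists 53, 100; split=> //; lia.
- by exists 62, 90; split=> //; lia.
Qed.

(** Losses of at least [s] in [V] and [c] in [W] bound the sum by the right-hand side times r^-c +
    r^-s, which is at most 1. *)
Lemma measure_branch (r : rat) (T : finType) (G : graph T) (U V W : {set T}) v :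
  branching_rate r ->
  v \in U -> 1 < deg G U v ->
  {in U, forall u, deg G U u <= deg G U v} ->
  V \subset U :\: (v |: [set u in U | G v u]) -> W \subset U :\ v ->
  (r ^+ measure G V + r ^+ measure G W <= r ^+ measure G U)%R.
Proof.
move=> [r1 rcs] vU deg1 maxv sV sW; set N := [set u in U | G v u].
have [c [s [cs lec les]]] : exists c s, [/\ (c, s) \in branchings,
    c <= weight #|N| + \sum_(u in N) (weight (deg G U u) - weight (deg G U u).-1) &
    s <= weight #|N| + \sum_(u in N) weight (deg G U u)].
  apply: branching_cover => // u; rewrite inE => /andP[uU vu].
  rewrite [_ <= #|N|]maxv // andbT card_gt0; apply/set0Pn; exists v.
  by rewrite inE vU adj_sym.
have r0 : (0 < r)%R by apply: lt_le_trans r1.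
have bound k m : k + m <= measure G U ->
    (r ^+ k <= r ^+ measure G U * r ^- m)%R.
  by move=> le; rewrite ler_pdivlMr ?exprn_gt0 // -exprD ler_weXn2l ?r1.
have leV := measure_closed_nbhd vU sV; have leW := measure_vertex G vU sW.
apply: le_trans (lerD (bound _ s _) (bound _ c _)) _.
- by apply: leq_trans leV; rewrite leq_add2l.
- by apply: leq_trans leW; rewrite leq_add2l.
rewrite -mulrDr ler_piMr //; first by rewrite exprn_ge0 // ltW.
by rewrite addrC rcs.
Qed.

Lemma measure_bound (n : nat) (G : graph 'I_n) (U : {set 'I_n}) :
  measure G U <= 26 * n.
Proof.
rewrite mulnC -[X in X * _]card_ord; apply: leq_trans (_ : #|U| * 26 <= _).
  rewrite -sum_nat_const; apply: leq_sum => u _.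
  by rewrite /weight; case: (deg _ _ _) => [|[|[|d]]] //=; rewrite nth_nil.
by rewrite leq_mul2r max_card orbT.
Qed.

(** * The branching algorithm *)

Definition hundecided := hmap 14 HLeaf.

(** The recursion over the search tree is not a bounded loop, so it is written directly as an
    [expr]. A plan with a single continuation is treated as a branching whose first alternative has
    failed. *)
Definition solve_body : expr :=
  ELet (compile hplan)
    (EIf (EVar 0)
       (EIf (EHd (EVar 0))
          (ELet (EIf (EHd (EHd (EVar 0)))
                     (ECall 1 (ENode (EHd (EVar 1)) (ETl (EHd (EHd (EVar 0))))))
                     ELeaf)
             (EIf (EVar 0)
                  (EVar 0)
                  (ECall 1 (ENode (EHd (EVar 2)) (ETl (EVar 1))))))
          (ETl (EVar 0)))
       ELeaf).

(** Compiled code expects the global tree paired with an argument in variable 0; the argument is a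
    dummy Leaf here. *)
Definition main_body : expr :=
  ELet (ENode (EVar 0) ELeaf)
    (ECall 1 (ENode (EHd (EVar 0)) (compile hundecided))).

Fixpoint loops (e : hexpr) : seq (nat * hexpr) :=
  match e with
  | HArg | HGlob | HLeaf => [::]
  | HNode a b | HApp a b => loops a ++ loops b
  | HHd a | HTl a => loops a
  | HIf a b c => loops a ++ loops b ++ loops c
  | HIter k b a => (k, b) :: loops b ++ loops a
  end.

(** A loop may occur many times, but a number always carries the same body, so the first occurrence
    suffices; [linked_plan] and [linked_undecided] verify this by computation. *)
Definition loop_of (k : nat) : hexpr :=
  head HLeaf [seq p.2 | p <- loops hplan ++ loops hundecided & p.1 == k].

Definition solver : program :=
  [:: main_body, solve_body & [seq loop_body k (loop_of k) | k <- iota 2 13]].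

Lemma linked_plan : linked solver hplan.
Proof. by vm_compute; repeat split. Qed.

Lemma linked_undecided : linked solver hundecided.
Proof. by vm_compute; repeat split. Qed.
Section Solve.
Variables (g l : tree).
Let plan := den g l hplan.
Let K := cost (spine g) hplan.
Local Notation solved l w T := (evals solver [:: Node g l] (body solver 1) w T).

Lemma solve_fail : plan = Leaf -> solved l Leaf (K + 40).
Proof.
(* The value takes the conditional form produced by [evals_if]; the unreachable branch then gets the
   vacuous bound 0. *)
move=> E; rewrite -[X in evals _ _ _ X _](if_same (is_node plan)).
apply: evals_le; last first.
  apply: evals_let; first exact: (compile_evals linked_plan).
  apply: (@evals_if _ _ _ _ _ plan Leaf Leaf _ 0 1) => [||_].
  - exact: (evals_var _ _ 0).
  - by rewrite E.
  - exact: evals_leaf.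
by rewrite E [is_node _]/= /K; move: (cost _ _) => k; lia.
Qed.

Lemma solve_done a : plan = Node Leaf a -> solved l a (K + 40).
Proof.
move=> E; have -> : a = if is_node plan then a else Leaf by rewrite E.
apply: evals_le; last first.
  apply: evals_let; first exact: (compile_evals linked_plan).
  apply: (@evals_if _ _ _ _ _ plan a Leaf _ 6 0) => [|_|].
  - exact: (evals_var _ _ 0).
  - have {1}-> : a = if is_node (tree_hd plan) then Leaf else a by rewrite E.
    apply: evals_le; last first.
      apply: (@evals_if _ _ _ _ _ (tree_hd plan) Leaf a _ 0 2) => [||_].
      - exact: (evals_hd (evals_var _ _ 0)).
      - by rewrite E.
      - have -> : a = tree_tl plan by rewrite E.
        exact: (evals_tl (evals_var _ _ 0)).
    by rewrite E.
  - by rewrite E.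
by rewrite E [is_node _]/= /K; move: (cost _ _) => k; lia.
Qed.

Lemma solve_branch o x l2 w1 w2 T1 T2 :
  plan = Node (Node o x) l2 ->
  (if is_node o then solved (tree_tl o) w1 T1 else w1 = Leaf) ->
  (~~ is_node w1 -> solved l2 w2 T2) ->
  solved l (if is_node w1 then w1 else w2)
    (K + 40 + (if is_node o then T1 else 0) + (if is_node w1 then 0 else T2)).
Proof.
move=> E H1 H2; set w := if is_node w1 then w1 else w2.
have -> : w = if is_node plan then w else Leaf by rewrite E.
apply: evals_le; last first.
  apply: evals_let; first exact: (compile_evals linked_plan).
  apply: (@evals_if _ _ _ _ _ plan _ Leaf _ _ 0) => [|_|].
  - exact: (evals_var _ _ 0).
  - have -> : w = if is_node (tree_hd plan) then w else Leaf by rewrite E.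
    apply: (@evals_if _ _ _ _ _ (tree_hd plan) _ Leaf _ _ 0) => [|_|].
    - exact: (evals_hd (evals_var _ _ 0)).
    - apply: (@evals_let _ _ _ _ w1).
        have -> : w1 = if is_node o then w1 else Leaf.
          by move: H1; case: (is_node o).
        apply: (@evals_if _ _ _ _ _ o _ Leaf 3 (T1 + 9) 1) => [|o1|_].
        - have -> : o = tree_hd (tree_hd plan) by rewrite E.
          exact: (evals_hd (evals_hd (evals_var _ _ 0))).
        - rewrite o1 in H1; apply: evals_le; last first.
            apply: evals_call; last exact: H1.
            apply: evals_node; first exact: (evals_hd (evals_var _ _ 1)).
            have -> : tree_tl o = tree_tl (tree_hd (tree_hd plan)) by rewrite E.
            exact: (evals_tl (evals_hd (evals_hd (evals_var _ _ 0)))).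
          by lia.
        - exact: evals_leaf.
      apply: (@evals_if _ _ _ _ _ w1 _ _ _ 1 (T2 + 6)) => [|_|w10].
      - exact: (evals_var _ _ 0).
      - exact: (evals_var _ _ 0).
      - apply: evals_le; last first.
          apply: evals_call; last exact: (H2 w10).
          apply: evals_node; first exact: (evals_hd (evals_var _ _ 2)).
          have -> : l2 = tree_tl plan by rewrite E.
          exact: (evals_tl (evals_var _ _ 1)).
        by lia.
    - by rewrite E.
  - by rewrite E.
rewrite E [is_node (Node _ _)]/= [is_node (tree_hd _)]/= /K; move: (cost _ _) => k.
by case: (is_node o); case: (is_node w1); lia.
Qed.

End Solve.

Lemma is_node_enc_answer n (a : option ({set 'I_n} * {set 'I_n})) :
  is_node (enc_answer a) = (a != None).
Proof. by case: a => [[]|]. Qed.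

(** Induction on a bound [k] for the residual set, which shrinks in every call. The measures of the
    children contribute at most [r ^+ m] in total, so each of the at most k + 1 levels costs at most
    the cost of one node times [r ^+ m]. *)
Lemma solve_residual (r : rat) n (G : graph 'I_n) k L :
  branching_rate r -> #|residual G L| <= k ->
  exists (a : option ({set 'I_n} * {set 'I_n})) (T : nat),
    [/\ evals solver [:: Node (enc_graph G) (enc_labels L)] (body solver 1)
          (enc_answer a) T,
        (T%:R <= ((cost n hplan + 40) * k.+1)%:R *
                   r ^+ measure G (residual G L))%R
      & if a is Some (C, J) then monopolar_partition G C J
        else ~ solvable G L].
Proof.
move=> rr; have [r1 _] := rr.
elim/ltn_ind: k L => k + L lek; move EK: (cost n hplan + 40) => K IH.
have Kn : cost (spine (enc_graph G)) hplan + 40 = K by rewrite spine_enc_graph EK.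
set m := measure G _.
have leK : (K%:R <= (K * k.+1)%:R * r ^+ m)%R.
  rewrite -[leLHS]mulr1 ler_pM ?ler0n ?ler01 ?exprn_ege1 //.
  by rewrite ler_nat leq_pmulr.
have leKm T (X : rat) : (T%:R <= (K * k)%:R * X)%R -> (X <= r ^+ m)%R ->
    ((K + T)%:R <= (K * k.+1)%:R * r ^+ m)%R.
  move=> leT leX; rewrite mulnS !natrD mulrDl lerD //.
    by rewrite -[leLHS]mulr1 ler_wpM2l ?ler0n ?exprn_ege1.
  by apply: le_trans leT _; rewrite ler_wpM2l ?ler0n.
have smaller (U V : {set 'I_n}) : V \subset U -> U \subset residual G L ->
    (r ^+ measure G V <= r ^+ m)%R.
  by move=> sV sU; rewrite ler_weXn2l // leq_measure // (subset_trans sV sU).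
have IHk L1 : #|residual G L1| < k -> exists a T,
    [/\ evals solver [:: Node (enc_graph G) (enc_labels L1)] (body solver 1)
          (enc_answer a) T,
        (T%:R <= (K * k)%:R * r ^+ measure G (residual G L1))%R
      & if a is Some (C, J) then monopolar_partition G C J
        else ~ solvable G L1].
  move=> lt1; have k0 : 0 < k by apply: leq_ltn_trans lt1.
  have := IH k.-1; rewrite prednK // leqnn => /(_ isT L1); apply.
  by rewrite -ltnS prednK.
have := den_hplan G L; move E: (den _ _ hplan) => p spec.
case: spec E => [nsol|C I part|L1 U sU ltU sol|L1 L2 U v sU vU dv maxv sV sW sol] E.
- exists None, K; split=> //; rewrite -Kn; exact: solve_fail.
- exists (Some (C, I)), K; split=> //; rewrite -Kn; exact: solve_done.
- have [|a [T [ev leT corr]]] := IHk L1.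
    exact: leq_trans (proper_card ltU) (leq_trans (subset_leq_card sU) lek).
  exists a, (K + T); split; last by case: a corr {ev} => // nsol /sol.
    have := solve_branch (w1 := Leaf) (T1 := 0) E erefl (fun _ => ev).
    by rewrite Kn addn0.
  by apply: leKm leT _; apply: smaller sU; apply: proper_sub.
have smallerU (X : {set 'I_n}) : X \subset U :\ v -> #|X| < k.
  move=> sX; apply: leq_trans (leq_trans (subset_leq_card sU) lek).
  by apply: proper_card; apply: sub_proper_trans (properD1 vU).
have [|a1 [T1 [ev1 leT1 corr1]]] := IHk L1.
  apply: smallerU; apply: subset_trans sV _; apply: setDS.
  exact: subsetUl.
have [|a2 [T2 [ev2 leT2 corr2]]] := IHk L2; first exact: smallerU.
exists (if a1 is Some _ then a1 else a2), (K + (T1 + T2)); split.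
- have := solve_branch E (w1 := enc_answer a1) (w2 := enc_answer a2) ev1 (fun _ => ev2).
  rewrite Kn [is_node (Node _ _)]/= -addnA is_node_enc_answer.
  by case: (a1) => [a1'|] /=; apply: evals_le; rewrite leq_add2l ?addn0 ?leq_addr.
- apply: (leKm _ (r ^+ measure G (residual G L1) + r ^+ measure G (residual G L2))%R).
    by rewrite natrD mulrDr lerD.
  apply: le_trans (measure_branch rr vU dv maxv sV sW) _.
  exact: smaller (subxx _) sU.
- case: a1 corr1 {ev1} => [//|nsol1]; case: a2 corr2 {ev2} => [//|nsol2].
  by move/sol=> [].
Qed.

(** * The time bound and the whole program *)

Local Open Scope ring_scope.

Lemma exponential_bound (r b : rat) (K T n m c : nat) :
  1 <= r -> r ^+ 26 <= b -> (m <= 26 * n)%N -> T%:R <= K%:R * r ^+ m ->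
  (T + c)%:R <= (K + c)%:R * b ^+ n.
Proof.
move=> r1 rb le_m leT; have r0 : 0 <= r := le_trans ler01 r1.
have b1 : 1 <= b by apply: le_trans rb; rewrite exprn_ege1.
have leb : r ^+ m <= b ^+ n.
  apply: le_trans (_ : r ^+ (26 * n) <= _); first by rewrite ler_weXn2l.
  by rewrite exprM lerXn2r ?nnegrE ?exprn_ge0 // (le_trans ler01).
rewrite !natrD mulrDl lerD ?ler_peMr ?exprn_ege1 //.
by apply: le_trans leT _; rewrite ler_wpM2l.
Qed.

Theorem theorem1 :
  exists (P : program) (T : nat -> nat),
    Ostar (fun n : nat => (13734%:R / 10000%:R) ^+ n) T /\
    forall (n : nat) (G : graph 'I_n),
      exists (answer : option ({set 'I_n} * {set 'I_n})) (t : nat),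
        [/\ run P (enc_graph G) (enc_answer answer) t,
            (t <= T n)%N
          & correct_answer G answer].
Proof.
have [r rr] := branching_rate_exists; have [r1 _] := rr.
move Eb: (13734%:R / 10000%:R) => b r26.
have b1 : 1 <= b by rewrite -Eb; lra.
have [cp Ecp] : exists f, f =1 cost^~ hplan by exists (cost^~ hplan).
have [cu Ecu] : exists f, f =1 cost^~ hundecided by exists (cost^~ hundecided).
pose K n := ((cp n + 40) * n.+1 + (cu n + 10))%N.
have pos n : 0 <= (K n)%:R * b ^+ n.
  apply: mulr_ge0; first exact: ler0n.
  by apply: exprn_ge0; exact: le_trans ler01 b1.
(* Numbers of steps are natural, so truncating the rational bound loses nothing. *)
exists solver, (fun n => Num.truncn ((K n)%:R * b ^+ n)); split.
  have [p Hp] := cost_poly hplan; have [q Hq] := cost_poly hundecided.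
  exists ((p + 40%:R%:P) * ('X + 1) + (q + 10%:R%:P)), 0 => n _.
  have /andP[tr _] := truncn_itv (pos n); apply: le_trans tr _.
  rewrite /K -[n.+1]addn1 natrD natrM 3!natrD Ecp Ecu Hp Hq.
  by rewrite hornerD hornerM !hornerD hornerX !hornerC lexx.
move=> n G.
pose L : {ffun 'I_n -> option bool} := [ffun=> None].
have Rn : (#|residual G L| <= n)%N by rewrite -[leqRHS]card_ord max_card.
have [a [T [ev leT corr]]] := solve_residual rr Rn; rewrite -Ecp in leT.
have [t let_t evt] : evals solver [:: enc_graph G] (body solver 0) (enc_answer a)
    (T + (cu n + 10)).
  apply: evals_le; last first.
    apply: evals_let.
      apply: evals_node; [exact: (evals_var _ _ 0) | exact: evals_leaf].
    apply: evals_call; last exact: ev.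
    apply: evals_node; first exact: (evals_hd (evals_var _ _ 0)).
    have -> : enc_labels L = den (enc_graph G) Leaf hundecided.
      rewrite /hundecided (den_hmap (spine_enc_graph G) 14 (F := fun=> Leaf)) => [|//].
      by congr enc_seq; apply: eq_map => i; rewrite ffunE.
    exact: (compile_evals linked_undecided).
  by rewrite spine_enc_graph Ecu; move: (cost _ _) => c; lia.
exists a, t; split; first exact: evt.
  rewrite truncn_ge_nat; last exact: pos.
  have bound := exponential_bound (cu n + 10) r1 r26 (measure_bound G _) leT.
  by apply: le_trans bound; rewrite ler_nat.
case: a corr {ev evt} => [[C J]|]; first exact.
move=> nsol /monopolarP[s vs]; apply: nsol; exists s; first exact: vs.
by move=> v c; rewrite ffunE.
Qed.
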